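(* Let $C\in\mathbb{R}^{Nn\times Nn}$ be a symmetric positive definite block tridiagonal matrix with diagonal blocks $b_k\in\mathbb{R}^{n\times n}$ ($k=1,\dots,N$), blocks $c_k\in\mathbb{R}^{n\times n}$ in block position $(k,k-1)$ and $c_k^{\mathrm T}$ in block position $(k-1,k)$ ($k=2,\dots,N$), and all other blocks zero, and let $r$ be the block column with blocks $r_k\in\mathbb{R}^{n\times\ell}$, $k=1,\dots,N$. Then the solution $e$ (with blocks $e_k\in\mathbb{R}^{n\times\ell}$) of $Ce=r$ is given by the two filter block tridiagonal algorithm, i.e. $$e_k=(d_k^f+d_k^b-b_k)^{-1}(s_k^f+s_k^b-r_k),\qquad k=1,\dots,N,$$ where $d_k^f,s_k^f,d_k^b,s_k^b$ are the forward and backward quantities defined in the context.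
   Context: Forward recursion: $d_1^f=b_1$, $s_1^f=r_1$, and for $k=2,\dots,N$, $d_k^f=b_k-c_k(d_{k-1}^f)^{-1}c_k^{\mathrm T}$, $s_k^f=r_k-c_k(d_{k-1}^f)^{-1}s_{k-1}^f$. Backward recursion: $d_N^b=b_N$, $s_N^b=r_N$, and for $k=N-1,\dots,1$, $d_k^b=b_k-c_{k+1}^{\mathrm T}(d_{k+1}^b)^{-1}c_{k+1}$, $s_k^b=r_k-c_{k+1}^{\mathrm T}(d_{k+1}^b)^{-1}s_{k+1}^b$. The two filter block tridiagonal algorithm runs both recursions and then outputs $e_k=(d_k^f+d_k^b-b_k)^{-1}(s_k^f+s_k^b-r_k)$ for $k=1,\dots,N$. *)

(* Defs.v *)
From mathcomp Require Import all_boot all_order all_algebra.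
From mathcomp Require Import reals.

Set Implicit Arguments.
Unset Strict Implicit.
Unset Printing Implicit Defensive.

Import Order.TTheory GRing.Theory Num.Theory.
Local Open Scope ring_scope.

(* Block indices are shifted by one: the blocks numbered 1, ..., N in the
   usual presentation are numbered 0, ..., N.-1 here.  Families of blocks are
   indexed by nat; only b 0, ..., b N.-1, r 0, ..., r N.-1 and
   c 1, ..., c N.-1 are meaningful. *)

Definition sympos_def (R : realType) (m : nat) (A : 'M[R]_m) : Prop :=
  A^T = A /\ forall x : 'cV[R]_m, x != 0 -> 0 < (x^T *m A *m x) 0 0.

Definition block_tridiag (R : realType) (N n : nat) (b c : nat -> 'M[R]_n) :
    'M[R]_(\sum_(i < N) n) :=
  \mxblock_(i < N, j < N)
    (if i == j :> nat then b i
     else if i == j.+1 :> nat then c i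
     else if j == i.+1 :> nat then (c j)^T
     else 0).

Fixpoint fwd_d (R : realType) (n : nat) (b c : nat -> 'M[R]_n) (k : nat) :
    'M[R]_n :=
  if k is k'.+1 then b k - c k *m invmx (fwd_d b c k') *m (c k)^T else b 0.

Fixpoint fwd_s (R : realType) (n l : nat) (b c : nat -> 'M[R]_n)
    (r : nat -> 'M[R]_(n, l)) (k : nat) : 'M[R]_(n, l) :=
  if k is k'.+1 then r k - c k *m invmx (fwd_d b c k') *m fwd_s b c r k'
  else r 0.

(* The backward recursion starts from the last block, so it is run on the
   distance j = N.-1 - k to that block; see bwd_d_last, bwd_d_rec, bwd_s_last
   and bwd_s_rec for the recursion in terms of k. *)
Fixpoint bwd_d_dist (R : realType) (N n : nat) (b c : nat -> 'M[R]_n)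
    (j : nat) : 'M[R]_n :=
  if j is j'.+1 then
    let k := (N.-1 - j)%N in
    b k - (c k.+1)^T *m invmx (bwd_d_dist N b c j') *m c k.+1
  else b N.-1.

Fixpoint bwd_s_dist (R : realType) (N n l : nat) (b c : nat -> 'M[R]_n)
    (r : nat -> 'M[R]_(n, l)) (j : nat) : 'M[R]_(n, l) :=
  if j is j'.+1 then
    let k := (N.-1 - j)%N in
    r k - (c k.+1)^T *m invmx (bwd_d_dist N b c j') *m bwd_s_dist N b c r j'
  else r N.-1.

Definition bwd_d (R : realType) (N n : nat) (b c : nat -> 'M[R]_n) (k : nat) :
  'M[R]_n := bwd_d_dist N b c (N.-1 - k).

Definition bwd_s (R : realType) (N n l : nat) (b c : nat -> 'M[R]_n)
    (r : nat -> 'M[R]_(n, l)) (k : nat) : 'M[R]_(n, l) :=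
  bwd_s_dist N b c r (N.-1 - k).

Lemma bwd_d_last (R : realType) (N n : nat) (b c : nat -> 'M[R]_n) :
  bwd_d N b c N.-1 = b N.-1.
Proof. by rewrite /bwd_d subnn. Qed.

Lemma bwd_s_last (R : realType) (N n l : nat) (b c : nat -> 'M[R]_n)
    (r : nat -> 'M[R]_(n, l)) :
  bwd_s N b c r N.-1 = r N.-1.
Proof. by rewrite /bwd_s subnn. Qed.

Lemma bwd_d_rec (R : realType) (N n : nat) (b c : nat -> 'M[R]_n) (k : nat) :
  (k.+1 < N)%N ->
  bwd_d N b c k = b k - (c k.+1)^T *m invmx (bwd_d N b c k.+1) *m c k.+1.
Proof.
case: N => // N; rewrite ltnS => ltkN.
by rewrite /bwd_d /= -(subnSK ltkN) /= subnSK // subKn // ltnW.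
Qed.

Lemma bwd_s_rec (R : realType) (N n l : nat) (b c : nat -> 'M[R]_n)
    (r : nat -> 'M[R]_(n, l)) (k : nat) :
  (k.+1 < N)%N ->
  bwd_s N b c r k =
    r k - (c k.+1)^T *m invmx (bwd_d N b c k.+1) *m bwd_s N b c r k.+1.
Proof.
case: N => // N; rewrite ltnS => ltkN.
by rewrite /bwd_s /bwd_d /= -(subnSK ltkN) /= subnSK // subKn // ltnW.
Qed.

(* invmx A is the inverse of A when A \in unitmx and A itself otherwise, so
   two_filter is meaningful only together with two_filter_defined, which says
   that every matrix inverted by the algorithm is invertible: the recursions
   invert d^f_k for all k but the last and d^b_k for all k but the first. *)
Definition two_filter_defined (R : realType) (N n : nat)
    (b c : nat -> 'M[R]_n) : Prop :=
  forall k : nat, (k < N)%N ->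
    [/\ (k.+1 < N)%N -> fwd_d b c k \in unitmx,
        (0 < k)%N -> bwd_d N b c k \in unitmx
      & fwd_d b c k + bwd_d N b c k - b k \in unitmx].

Definition two_filter (R : realType) (N n l : nat) (b c : nat -> 'M[R]_n)
    (r : nat -> 'M[R]_(n, l)) (k : nat) : 'M[R]_(n, l) :=
  invmx (fwd_d b c k + bwd_d N b c k - b k)
    *m (fwd_s b c r k + bwd_s N b c r k - r k).

(* Main.v *)
Require Import Defs.
From mathcomp Require Import all_boot all_order all_algebra.
From mathcomp Require Import reals.
From mathcomp Require Import zify ring lra.

Set Implicit Arguments.
Unset Strict Implicit.
Unset Printing Implicit Defensive.

Import Order.TTheory GRing.Theory Num.Theory.
Local Open Scope ring_scope.

(** The forward recursion is block Gaussian elimination from the top.  If the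
block rows above the k-th hold, they can be used to eliminate e_{k-1} from
the k-th row, which becomes

    d^f_k e_k + c_{k+1}^T e_{k+1} = s^f_k    ([fwd_elim]).

The backward recursion is the same elimination from the bottom, with outcome
c_k e_{k-1} + d^b_k e_k = s^b_k ([bwd_elim]).  Adding the two and subtracting
the original row c_k e_{k-1} + b_k e_k + c_{k+1}^T e_{k+1} = r_k cancels both
neighbours of e_k and leaves ([two_filter_row])

    (d^f_k + d^b_k - b_k) e_k = s^f_k + s^b_k - r_k.

It remains to see that all the matrices to be inverted are invertible.
Positive definiteness of C enters only through the following consequence
([principal_regular]): a block vector x such that, for each k, x_k = 0 or
(C x)_k = 0, satisfies x^T C x = 0 and is therefore zero.
- If d^f_k v = 0, back substitution from x_k = v, with x_j = 0 for j > k,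
  makes (C x)_j = 0 for all j < k; also (C x)_k = d^f_k v = 0 by the
  elimination identity, so x = 0 and v = 0 ([fwd_d_unit]).
- Numbering the blocks in the opposite order exchanges the two recursions and
  preserves this property, which gives the invertibility of d^b_k
  ([bwd_d_unit]).
- For the right-hand side whose k-th block is the identity, all other blocks
  being zero, s^f_k + s^b_k - r_k is the identity.  Hence d^f_k + d^b_k - b_k
  is invertible, its inverse being the k-th diagonal block of the inverse of C
  ([pivot_unit]).

Uniqueness of the solution, that is invertibility of C, then yields both
directions of the equivalence. *)

(** * Block rows of the tridiagonal operator *)

(** Vectors of blocks are sequences of blocks indexed by [nat], of which only the
    first [N] terms matter; the boundary rows lack one of the two neighbours. *)
Definition prev_term (R : realType) (n l : nat) (c : nat -> 'M[R]_n)
    (x : nat -> 'M[R]_(n, l)) (k : nat) : 'M[R]_(n, l) :=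
  if k is k'.+1 then c k *m x k' else 0.

Definition next_term (R : realType) (N n l : nat) (c : nat -> 'M[R]_n)
    (x : nat -> 'M[R]_(n, l)) (k : nat) : 'M[R]_(n, l) :=
  if (k.+1 < N)%N then (c k.+1)^T *m x k.+1 else 0.

Definition tri_row (R : realType) (N n l : nat) (b c : nat -> 'M[R]_n)
    (x : nat -> 'M[R]_(n, l)) (k : nat) : 'M[R]_(n, l) :=
  prev_term c x k + b k *m x k + next_term N c x k.

Lemma block_tridiag_mul (R : realType) (N n l : nat) (b c : nat -> 'M[R]_n)
    (x : nat -> 'M[R]_(n, l)) :
  block_tridiag N b c *m \mxcol_(i < N) x i =
    \mxcol_(i < N) tri_row N b c x i.
Proof.
rewrite /block_tridiag mul_mxblock_mxrow; apply: eq_mxcol => k.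
rewrite /tri_row [prev_term _ _ _ + _]addrC.
transitivity (\sum_(j < N)
   ((if j == k :> nat then b j *m x j else 0)
    + (if j.+1 == k then c j.+1 *m x j else 0)
    + (if j == k.+1 :> nat then (c j)^T *m x j else 0))).
  (* The three cases of the definition of a block are mutually exclusive. *)
  apply: eq_bigr => j _ /=; move: (k : nat) (j : nat) => {}k {}j.
  rewrite [k == j]eq_sym [k == j.+1]eq_sym.
  have [->|nkj] := eqVneq j k.
    by rewrite !ifN ?addr0 //; lia.
  have [<-|nkj1] := eqVneq j.+1 k.
    by rewrite ifN ?addr0 ?add0r //; lia.
  by rewrite !add0r; case: ifP; rewrite ?mul0mx.
rewrite !big_split -!big_mkcond /=; congr (_ + _ + _).
- by rewrite (big_ord1_eq _ (fun j => b j *m x j)) ltn_ord.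
- case: k => [[|k] ltkN] /=; first by rewrite big1.
  under eq_bigl do rewrite eqSS.
  by rewrite (big_ord1_eq _ (fun j => c j.+1 *m x j)) ltnW.
- by rewrite (big_ord1_eq _ (fun j => (c j)^T *m x j)).
Qed.

Lemma unitmx_ker (F : fieldType) (m : nat) (A : 'M[F]_m) :
  (forall v : 'cV[F]_m, A *m v = 0 -> v = 0) -> A \in unitmx.
Proof.
move=> kerA; rewrite -unitmx_tr -row_free_unit; apply: inj_row_free => v vA.
apply: trmx_inj; rewrite trmx0; apply: kerA.
by rewrite -[A]trmxK -trmx_mul vA trmx0.
Qed.

(** Equivalently, every principal block submatrix is invertible: the submatrix
    on the set of indices [k] where the second alternative is taken has trivial
    kernel.  Unlike positive definiteness of the full matrix, this speaks about
    block rows only and visibly survives reversal of the block order. *)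
Definition principal_regular (R : realType) (N n : nat)
    (b c : nat -> 'M[R]_n) : Prop :=
  forall x : nat -> 'cV[R]_n,
    (forall k, (k < N)%N -> x k = 0 \/ tri_row N b c x k = 0) ->
  forall k, (k < N)%N -> x k = 0.

(** Each term of x^T C x = \sum_i x_i^T (C x)_i vanishes. *)
Lemma sympos_principal_regular (R : realType) (N n : nat)
    (b c : nat -> 'M[R]_n) :
  sympos_def (block_tridiag N b c) -> principal_regular N b c.
Proof.
case=> _ posC x x0 k ltkN; pose X := \mxcol_(i < N) x i.
have [X0|/posC] := eqVneq X 0.
  by rewrite -(mxcolK (fun i : 'I_N => x i) (Ordinal ltkN)) -/X X0 submxcol0.
rewrite -mulmxA block_tridiag_mul tr_mxcol mul_mxrow_mxcol big1 ?mxE ?ltxx //.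
by move=> i _; case: (x0 i) => // ->; rewrite ?trmx0 (mul0mx, mulmx0).
Qed.

Definition block_seq (R : realType) (N n l : nat)
    (e : 'M[R]_(\sum_(i < N) n, l)) (k : nat) : 'M[R]_(n, l) :=
  oapp (fun i : 'I_N => submxcol e i) 0 (insub k).

Lemma block_seqE (R : realType) (N n l : nat)
    (e : 'M[R]_(\sum_(i < N) n, l)) (i : 'I_N) :
  block_seq e i = submxcol e i.
Proof. by rewrite /block_seq valK. Qed.

Lemma block_seqK (R : realType) (N n l : nat)
    (e : 'M[R]_(\sum_(i < N) n, l)) : \mxcol_(i < N) block_seq e i = e.
Proof. by under eq_mxcol do rewrite block_seqE; rewrite submxcolK. Qed.

Lemma block_tridiag_eqP (R : realType) (N n l : nat) (b c : nat -> 'M[R]_n)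
    (r : nat -> 'M[R]_(n, l)) (e : 'M[R]_(\sum_(i < N) n, l)) :
  block_tridiag N b c *m e = \mxcol_(i < N) r i <->
  forall k, (k < N)%N -> tri_row N b c (block_seq e) k = r k.
Proof.
rewrite -{1}[e]block_seqK block_tridiag_mul; split=> [eqr k ltkN|eqr].
  have /mxcolP/(_ (Ordinal ltkN)) := eqr; rewrite 2!mxcolK; exact.
by apply: eq_mxcol => i; apply: eqr.
Qed.

Lemma block_tridiag_unit (R : realType) (N n : nat) (b c : nat -> 'M[R]_n) :
  principal_regular N b c -> block_tridiag N b c \in unitmx.
Proof.
move=> regC; apply: unitmx_ker => v Cv0.
have [v0 _] := block_tridiag_eqP b c (fun=> 0) v.
rewrite -[v]block_seqK -[RHS]mxcol0; apply: eq_mxcol => i.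
by apply: regC => // k ltkN; right; apply: v0; rewrite // mxcol0.
Qed.

(** * Forward elimination *)

(** Only the rows above the [k]-th are assumed to hold.  Keeping row [k] as an
    identity rather than an equation lets the lemma serve both for solutions and
    for the partial solutions built by back substitution. *)
Lemma fwd_elim (R : realType) (N n l : nat) (b c : nat -> 'M[R]_n)
    (r x : nat -> 'M[R]_(n, l)) (k : nat) :
    (k < N)%N ->
    (forall j, (j < k)%N -> fwd_d b c j \in unitmx) ->
    (forall j, (j < k)%N -> tri_row N b c x j = r j) ->
  tri_row N b c x k =
    fwd_d b c k *m x k + next_term N c x k + (r k - fwd_s b c r k).
Proof.
elim: k => [|k IHk] ltkN unitd solx.
  by rewrite /tri_row /= add0r subrr addr0.
rewrite /tri_row /=.
have row_k : fwd_d b c k *m x k = fwd_s b c r k - (c k.+1)^T *m x k.+1.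
  have : tri_row N b c x k = r k by apply: solx.
  rewrite IHk => [|||]; [|lia|move=> j ltjk; apply: unitd; lia
                         |move=> j ltjk; apply: solx; lia].
  rewrite /next_term ltkN => /(canRL (addrK _)) /(canRL (addrK _)) ->.
  by congr (_ - _); rewrite opprB addrC subrK.
have {1}-> : x k = invmx (fwd_d b c k) *m (fwd_d b c k *m x k).
  by rewrite mulKmx // unitd.
rewrite row_k; move: (next_term _ _ _ _) => nx.
rewrite mulmxBr mulmxBl !mulmxBr !mulmxA.
by apply/matrixP => i j; rewrite !mxE; ring.
Qed.

(** No elimination step changes the right-hand side before its first nonzero
    block. *)
Lemma fwd_s_first (R : realType) (n l : nat) (b c : nat -> 'M[R]_n)
    (r : nat -> 'M[R]_(n, l)) (k : nat) :
  (forall j, (j < k)%N -> r j = 0) -> fwd_s b c r k = r k.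
Proof.
elim: k => //= k IHk r0; rewrite IHk => [|j ltjk]; last by apply: r0; lia.
by rewrite (r0 k) // mulmx0 subr0.
Qed.

(** Prescribing the blocks from the [k]-th on, the earlier ones can be chosen so
    as to solve the homogeneous rows above: x_j = - (d^f_j)^-1 c_{j+1}^T x_{j+1},
    in the order j = k-1, ..., 0.  The tail [y] is arbitrary so that the
    induction can extend it downwards one block at a time. *)
Lemma back_subst (R : realType) (N n l : nat) (b c : nat -> 'M[R]_n)
    (k : nat) (y : nat -> 'M[R]_(n, l)) :
    (k < N)%N ->
    (forall j, (j < k)%N -> fwd_d b c j \in unitmx) ->
  exists x : nat -> 'M[R]_(n, l),
    (forall j, (k <= j)%N -> x j = y j) /\
    (forall j, (j < k)%N -> tri_row N b c x j = 0).
Proof.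
elim: k y => [|k IHk] y ltkN unitd; first by exists y.
pose xk := - (invmx (fwd_d b c k) *m next_term N c y k).
have [|j ltjk|x [xy x0]] := IHk (fun j => if j == k then xk else y j).
- exact: ltnW.
- by apply: unitd; lia.
have xyS j : (k < j)%N -> x j = y j.
  by move=> ltkj; rewrite xy ?ifN //; lia.
exists x; split=> // j; rewrite ltnS leq_eqVlt => /orP[/eqP->|/x0 //].
rewrite (fwd_elim (r := fun=> 0)) //; last first.
- by move=> i ltik; apply: unitd; lia.
- exact: ltnW.
rewrite fwd_s_first // subrr addr0 xy // eqxx mulmxN mulKVmx ?unitd //.
by rewrite /next_term xyS // addNr.
Qed.

(** A kernel vector of d^f_k would extend, by back substitution above and by zero
    below, to a block vector excluded by [principal_regular]. *)
Lemma fwd_d_unit (R : realType) (N n : nat) (b c : nat -> 'M[R]_n) (k : nat) :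
  principal_regular N b c -> (k < N)%N -> fwd_d b c k \in unitmx.
Proof.
move=> regC; have [m] := ubnP k; elim: m k => // m IHm k ltkm ltkN.
have unitd j : (j < k)%N -> fwd_d b c j \in unitmx.
  by move=> ltjk; apply: IHm; lia.
apply: unitmx_ker => v dv0.
have [x [xy x0]] := back_subst (fun j => if j == k then v else 0) ltkN unitd.
have xk : x k = v by rewrite xy ?eqxx.
rewrite -xk; apply: regC => // j ltjN.
have [ltjk|ltkj|->] := ssrnat.ltngtP j k; first by right; apply: x0.
  by left; rewrite xy ?ifN //; lia.
right; rewrite (fwd_elim (r := fun=> 0)) // fwd_s_first // subrr addr0 xk dv0.
rewrite /next_term xy // [_ == k]gtn_eqF //.
by rewrite mulmx0 if_same addr0.
Qed.

(** * Backward elimination by reversing the block order *)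

Definition rev_blocks (T : Type) (N : nat) (x : nat -> T) (k : nat) : T :=
  x (N.-1 - k)%N.

(** The block in position (k, k-1) of the reversed matrix is the original block in
    position (N-1-k, N-k), which lies above the diagonal: the transpose of
    c_{N-k}. *)
Definition rev_offdiag (R : realType) (N n : nat) (c : nat -> 'M[R]_n)
    (k : nat) : 'M[R]_n := (c (N - k)%N)^T.

Lemma bwd_d_rev (R : realType) (N n : nat) (b c : nat -> 'M[R]_n) (k : nat) :
    (k < N)%N ->
  bwd_d N b c k = fwd_d (rev_blocks N b) (rev_offdiag N c) (N.-1 - k).
Proof.
move=> ltkN; rewrite /bwd_d; have: (N.-1 - k < N)%N by lia.
elim: (N.-1 - k)%N => /= [|j IHj] ltjN; first by rewrite /rev_blocks subn0.
rewrite IHj 1?ltnW // /rev_offdiag trmxK.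
by have -> : ((N.-1 - j.+1).+1 = N - j.+1)%N by lia.
Qed.

Lemma bwd_s_rev (R : realType) (N n l : nat) (b c : nat -> 'M[R]_n)
    (r : nat -> 'M[R]_(n, l)) (k : nat) :
    (k < N)%N ->
  bwd_s N b c r k =
    fwd_s (rev_blocks N b) (rev_offdiag N c) (rev_blocks N r) (N.-1 - k).
Proof.
move=> ltkN; rewrite /bwd_s; have: (N.-1 - k < N)%N by lia.
elim: (N.-1 - k)%N => /= [|j IHj] ltjN; first by rewrite /rev_blocks subn0.
have := @bwd_d_rev R N n b c (N.-1 - j); rewrite /bwd_d subKn; last by lia.
move=> ->; last by lia.
rewrite IHj 1?ltnW // /rev_offdiag.
by have -> : ((N.-1 - j.+1).+1 = N - j.+1)%N by lia.
Qed.

Lemma rev_ordK (N k : nat) : (k < N)%N -> (N.-1 - (N.-1 - k) = k)%N.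
Proof. lia. Qed.

(** [y] is only required to agree with the reversal of [x] on the first [N]
    blocks, because reversing twice is the identity on those alone. *)
Lemma tri_row_rev (R : realType) (N n l : nat) (b c : nat -> 'M[R]_n)
    (x y : nat -> 'M[R]_(n, l)) (k : nat) :
    (forall j, (j < N)%N -> y j = x (N.-1 - j)%N) -> (k < N)%N ->
  [/\ prev_term (rev_offdiag N c) y k = next_term N c x (N.-1 - k),
      next_term N (rev_offdiag N c) y k = prev_term c x (N.-1 - k)
    & tri_row N (rev_blocks N b) (rev_offdiag N c) y k
        = tri_row N b c x (N.-1 - k)].
Proof.
move=> yx ltkN.
have prevE : prev_term (rev_offdiag N c) y k = next_term N c x (N.-1 - k).
  rewrite /next_term; case: k ltkN => [|k] ltkN /=; first by rewrite ifN //; lia.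
  rewrite yx ?ifT /rev_offdiag; try lia.
  by have [-> ->] :
    (N - k.+1 = (N.-1 - k.+1).+1 /\ N.-1 - k = (N.-1 - k.+1).+1)%N by lia.
have nextE : next_term N (rev_offdiag N c) y k = prev_term c x (N.-1 - k).
  rewrite /next_term; case: ifP => ltSkN; last first.
    by have -> : (N.-1 - k = 0)%N by lia.
  rewrite yx // /rev_offdiag trmxK.
  by have [-> ->] :
    (N.-1 - k = (N.-1 - k.+1).+1 /\ N - k.+1 = (N.-1 - k.+1).+1)%N by lia.
split=> //; rewrite /tri_row prevE nextE yx // /rev_blocks.
by rewrite addrC [next_term _ _ _ _ + _]addrC addrA.
Qed.

Lemma principal_regular_rev (R : realType) (N n : nat) (b c : nat -> 'M[R]_n) :
    principal_regular N b c ->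
  principal_regular N (rev_blocks N b) (rev_offdiag N c).
Proof.
move=> regC x x0 k ltkN; rewrite -(rev_ordK ltkN).
have revx j : (j < N)%N -> x j = rev_blocks N x (N.-1 - j).
  by move=> ltjN; rewrite /rev_blocks rev_ordK.
apply: (regC (rev_blocks N x)) => [j ltjN|]; last by lia.
have ltrjN : (N.-1 - j < N)%N by lia.
have [xj0|] := x0 _ ltrjN; first by left.
by have [_ _ ->] := tri_row_rev b c revx ltrjN; rewrite rev_ordK //; right.
Qed.

Lemma bwd_d_unit (R : realType) (N n : nat) (b c : nat -> 'M[R]_n) (k : nat) :
  principal_regular N b c -> (k < N)%N -> bwd_d N b c k \in unitmx.
Proof.
move=> /principal_regular_rev regC ltkN; rewrite bwd_d_rev //.
by apply: (fwd_d_unit regC); lia.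
Qed.

Lemma bwd_elim (R : realType) (N n l : nat) (b c : nat -> 'M[R]_n)
    (r x : nat -> 'M[R]_(n, l)) (k : nat) :
    (k < N)%N ->
    (forall j, (k < j < N)%N -> bwd_d N b c j \in unitmx) ->
    (forall j, (k < j < N)%N -> tri_row N b c x j = r j) ->
  tri_row N b c x k =
    bwd_d N b c k *m x k + prev_term c x k + (r k - bwd_s N b c r k).
Proof.
move=> ltkN unitd solx; have ltrkN : (N.-1 - k < N)%N by lia.
have revx j : (j < N)%N -> rev_blocks N x j = x (N.-1 - j)%N by [].
have [_ nextE rowE] := tri_row_rev b c revx ltrkN.
rewrite -(rev_ordK ltkN) -rowE -nextE (fwd_elim (r := rev_blocks N r)) //.
- by rewrite rev_ordK // bwd_d_rev // bwd_s_rev // /rev_blocks rev_ordK.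
- move=> j ltjk; rewrite -(@rev_ordK N j); last by lia.
  by rewrite -bwd_d_rev ?unitd //; lia.
- move=> j ltjk; have [|_ _ ->] := tri_row_rev b c revx (k := j); first by lia.
  by rewrite solx //; lia.
Qed.

Lemma bwd_s_first (R : realType) (N n l : nat) (b c : nat -> 'M[R]_n)
    (r : nat -> 'M[R]_(n, l)) (k : nat) :
    (k < N)%N -> (forall j, (k < j < N)%N -> r j = 0) ->
  bwd_s N b c r k = r k.
Proof.
move=> ltkN r0; rewrite bwd_s_rev // fwd_s_first /rev_blocks ?rev_ordK //.
by move=> j ltjk; apply: r0; lia.
Qed.

(** * Combining the two sweeps *)

(** Forward elimination keeps the right neighbour of x_k, backward elimination
    the left one, and row [k] has both; the combination forward + backward - row
    contains x_k only. *)
Lemma two_filter_row (R : realType) (N n l : nat) (b c : nat -> 'M[R]_n)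
    (r x : nat -> 'M[R]_(n, l)) (k : nat) :
    principal_regular N b c ->
    (forall j, (j < N)%N -> tri_row N b c x j = r j) -> (k < N)%N ->
  (fwd_d b c k + bwd_d N b c k - b k) *m x k
    = fwd_s b c r k + bwd_s N b c r k - r k.
Proof.
move=> regC solx ltkN.
have fwdE : r k = fwd_d b c k *m x k + next_term N c x k
                  + (r k - fwd_s b c r k).
  rewrite -fwd_elim ?solx // => j ltjk; first by apply: (fwd_d_unit regC); lia.
  by apply: solx; lia.
have bwdE : r k = bwd_d N b c k *m x k + prev_term c x k
                  + (r k - bwd_s N b c r k).
  rewrite -bwd_elim ?solx // => j /andP[_ ltjN]; last exact: solx.
  exact: (bwd_d_unit regC).
(* Entrywise, the claim is a linear combination of the three equations. *)
have rowE := solx k ltkN; rewrite /tri_row in rowE.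
rewrite mulmxBl mulmxDl.
apply/matrixP => i j.
move: fwdE bwdE rowE => /matrixP/(_ i j) + /matrixP/(_ i j) + /matrixP/(_ i j).
rewrite !mxE; lra.
Qed.

(** The [k]-th block column of the inverse of C solves the system whose
    right-hand side is [delta]; its [k]-th block is a right inverse of the
    pivot. *)
Lemma pivot_unit (R : realType) (N n : nat) (b c : nat -> 'M[R]_n) (k : nat) :
    principal_regular N b c -> (k < N)%N ->
  fwd_d b c k + bwd_d N b c k - b k \in unitmx.
Proof.
move=> regC ltkN; pose delta j : 'M[R]_n := if j == k then 1%:M else 0.
pose e := invmx (block_tridiag N b c) *m \mxcol_(i < N) delta i.
have /block_tridiag_eqP sole : block_tridiag N b c *m e = \mxcol_(i < N) delta i.
  by rewrite mulKVmx // block_tridiag_unit.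
have := two_filter_row regC sole ltkN.
rewrite fwd_s_first => [|j ltjk]; last by rewrite /delta ifN //; lia.
rewrite bwd_s_first // => [|j ltjk]; last by rewrite /delta ifN //; lia.
by rewrite addrK /delta eqxx => /mulmx1_unit[].
Qed.

Theorem mainTheorem8 (R : realType) (N n l : nat) (b c : nat -> 'M[R]_n)
    (r : nat -> 'M[R]_(n, l)) (hC : sympos_def (block_tridiag N b c)) :
  two_filter_defined N b c /\
  forall e : 'M[R]_(\sum_(i < N) n, l),
    block_tridiag N b c *m e = \mxcol_(i < N) r i <->
    forall k : 'I_N, submxcol e k = two_filter N b c r k.
Proof.
have regC := sympos_principal_regular hC.
split=> [k ltkN|e].
  by split=> *; [apply: fwd_d_unit regC _ | apply: bwd_d_unit | apply: pivot_unit].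
have sol_blocks (u : 'M[R]_(\sum_(i < N) n, l)) :
    block_tridiag N b c *m u = \mxcol_(i < N) r i ->
  forall k : 'I_N, submxcol u k = two_filter N b c r k.
  move=> /block_tridiag_eqP solu k.
  rewrite /two_filter -(two_filter_row regC solu (ltn_ord k)) mulKmx.
    by rewrite block_seqE.
  exact: pivot_unit.
split=> [|eE]; first exact: sol_blocks.
pose u := invmx (block_tridiag N b c) *m \mxcol_(i < N) r i.
have solu : block_tridiag N b c *m u = \mxcol_(i < N) r i.
  by rewrite mulKVmx // block_tridiag_unit.
suff -> : e = u by [].
by apply/mxcolP => i; rewrite eE sol_blocks.
Qed.
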